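(* Let $a_0,a_2,b_0,b_1,b_2,\mu$ be indeterminates, $\mathbf{x}=(a_0,a_2,b_0,b_1,b_2,\mu)$. Let $[T_{n,k}]_{n,k\ge0}$ satisfy $T_{0,0}=1$, $T_{n,k}=0$ unless $0\le k\le n$, and for $n\ge1$ $$T_{n,k}=(a_0n-\mu b_1k+a_2)T_{n-1,k}+(b_0n+b_1k+b_2)T_{n-1,k-1}.$$ Let $T_n(q)=\sum_{k\ge0}T_{n,k}q^k$. Then $(T_n(\mu))_{n\ge0}$ is an $\mathbf{x}$-Stieltjes moment sequence.
   Context: For indeterminates $\mathbf{x}$, a matrix is $\mathbf{x}$-totally positive if every minor is a polynomial in $\mathbf{x}$ with nonnegative coefficients; a sequence is an $\mathbf{x}$-Stieltjes moment sequence if its Hankel matrix $[\alpha_{i+j}]_{i,j\ge0}$ is $\mathbf{x}$-totally positive. *)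

(* Defs.v *)
From mathcomp Require Import all_boot all_order all_algebra.
From mathcomp Require Import mpoly.

Set Implicit Arguments.
Unset Strict Implicit.
Unset Printing Implicit Defensive.

Import GRing.Theory Num.Theory.
Local Open Scope ring_scope.

Section TotalPositivity.
Context {R : numDomainType} {n : nat}.
Implicit Types (M : nat -> nat -> {mpoly R[n]}) (u : nat -> {mpoly R[n]}).

(* Infinite matrices are functions of two natural numbers; a minor is given by
   strictly increasing finite families of row and column indices. *)
Definition x_totally_positive M : Prop :=
  forall (m : nat) (i j : 'I_m -> nat),
    {homo i : r s / (r < s)%N} -> {homo j : r s / (r < s)%N} ->
    \det (\matrix_(r < m, s < m) M (i r) (j s)) \is a mpolyOver n Num.nneg.

Definition hankel u : nat -> nat -> {mpoly R[n]} := fun i j => u (i + j)%N.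

Definition x_Stieltjes_moment u : Prop := x_totally_positive (hankel u).

End TotalPositivity.

(* For a lower triangular array the sum over all k >= 0 stops at k = n. *)
Definition row_gen {P : nzRingType} (T : nat -> nat -> P) (n : nat) : {poly P} :=
  \poly_(k < n.+1) T n k.

(* Main.v *)
(** Evaluating the recurrence at [q = mu] cancels the terms containing [k], so
    [T_n(mu)] is the product of the factors [z + x l] for [l < n], where
    [x = a0 + b0 mu] and [z = a0 + a2 + (b0 + b1 + b2) mu]. Writing [p i j] for
    the product of [z + x l] over [i <= l < i + j], the Hankel entry at [(i, j)]
    is [p 0 i * p i j], so it suffices to treat the minors of [p]. If the first
    column index is positive, every row has the factor [z + x i], since
    [p i (j + 1) = (z + x i) * p (i + 1) j]. If it is [0], the first column is
    constantly [1]; subtracting from each row the previous one and using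
    [p (i + 1) j - p i j = j x * p (i + 1) (j - 1)], multilinearity expresses the
    minor as a nonnegative combination of minors of smaller order. *)
Require Import Defs.
From HB Require Import structures.
From mathcomp Require Import all_boot all_order all_algebra mpoly.
From mathcomp Require Import ring.

Set Implicit Arguments.
Unset Strict Implicit.
Unset Printing Implicit Defensive.

Import GRing.Theory Num.Theory.
Local Open Scope ring_scope.

Section Determinants.
Context {A : comNzRingType}.

Lemma det_scale_rows_cols m (c d : 'I_m -> A) (F : 'I_m -> 'I_m -> A) :
  \det (\matrix_(r, s) (c r * d s * F r s)) =
  (\prod_r c r) * (\prod_s d s) * \det (\matrix_(r, s) F r s).
Proof.
have -> : \matrix_(r, s) (c r * d s * F r s) =
    diag_mx (\row_r c r) *m (\matrix_(r, s) F r s) *m diag_mx (\row_s d s).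
  by apply/matrixP=> r s; rewrite mul_mx_diag mul_diag_mx !mxE; ring.
rewrite !det_mulmx !det_diag mulrAC.
by do 2 congr (_ * _); apply: eq_bigr => r _; rewrite mxE.
Qed.

(** Multilinearity in the rows: in the Leibniz formula each product of row sums distributes over the
    ways [f] to pick one summand per row. *)
Lemma det_sum_rows m (J : finType) (Q : 'I_m -> pred J) (F : J -> 'I_m -> A) :
  \det (\matrix_(r, s) \sum_(t | Q r t) F t s) =
  \sum_(f in family Q) \det (\matrix_(r, s) F (f r) s).
Proof.
rewrite /determinant exchange_big /=; apply: eq_bigr => sg _.
rewrite -big_distrr /=; congr (_ * _).
under eq_bigr do rewrite mxE.
rewrite bigA_distr_big_dep; apply: eq_bigr => f _.
by apply: eq_bigr => r _; rewrite mxE.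
Qed.

(** Left multiplication by the unit lower bidiagonal [U] subtracts from each row the previous one.
    The first column then has a single nonzero entry, the 1 on top, along which the determinant is
    expanded. *)
Lemma det_col1_row_diff m (F : nat -> 'I_m.+1 -> A) :
  (forall r, F r ord0 = 1) ->
  \det (\matrix_(r < m.+1, s < m.+1) F r s) =
  \det (\matrix_(r < m, s < m) (F r.+1 (lift ord0 s) - F r (lift ord0 s))).
Proof.
move=> F0.
pose U : 'M[A]_m.+1 := \matrix_(r, s) ((r == s)%:R - (s.+1 == r :> nat)%:R).
have detU : \det U = 1.
  rewrite det_trig.
    by apply: big1 => r _; rewrite mxE eqxx -[_ == _ :> nat]negbK neq_ltn ltnSn orbT subr0.
  apply/is_trig_mxP => r s ltrs; rewrite mxE.
  have -> : (r == s) = false by apply: ltn_eqF.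
  have -> : (s.+1 == r :> nat) = false by apply: gtn_eqF; apply: ltnW.
  by rewrite subr0.
have UM r s : (U *m \matrix_(r < m.+1, s < m.+1) F r s) r s =
    F r s - (if (r : nat) is r'.+1 then F r' s else 0).
  rewrite mxE; under eq_bigr do rewrite !mxE mulrBl.
  rewrite sumrB (bigD1 r) //= eqxx mul1r big1 ?addr0; last first.
    by move=> t ne; rewrite eq_sym (negPf ne) mul0r.
  congr (_ - _); case: r => [[|r'] ltr] /=.
    by apply: big1 => t _; rewrite mul0r.
  rewrite (bigD1 (Ordinal (ltnW ltr))) //= eqxx mul1r big1 ?addr0 // => t ne.
  by rewrite eqSS [_ == _ :> nat](_ : _ = (t == Ordinal (ltnW ltr))) // (negPf ne) mul0r.
rewrite -[LHS]mul1r -detU -det_mulmx (expand_det_col _ ord0) big_ord_recl.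
rewrite UM subr0 F0 mul1r [X in _ + X]big1 => [|r _]; last first.
  by rewrite UM /= !F0 subrr mul0r.
rewrite addr0 /cofactor expr0 mul1r; congr (\det _).
by apply/matrixP => r s; rewrite [LHS]mxE [LHS]mxE UM mxE.
Qed.

End Determinants.

Section ArithmeticProducts.
Context {A : comNzRingType} (z x : A).

Definition arith_prod (i j : nat) : A := \prod_(i <= l < i + j) (z + x * l%:R).

Lemma arith_prod0 i : arith_prod i 0 = 1.
Proof. by rewrite /arith_prod addn0 big_geq. Qed.

Lemma arith_prodSl i j : arith_prod i j.+1 = (z + x * i%:R) * arith_prod i.+1 j.
Proof. by rewrite /arith_prod big_ltn -addSnnS // leq_addr. Qed.

Lemma arith_prodSr i j :
  arith_prod i j.+1 = arith_prod i j * (z + x * (i + j)%:R).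
Proof. by rewrite /arith_prod addnS big_nat_recr //= leq_addr. Qed.

Lemma arith_prodD i j k :
  arith_prod i (j + k) = arith_prod i j * arith_prod (i + j) k.
Proof.
by rewrite /arith_prod addnA (big_cat_nat (n := (i + j)%N)) ?leq_addr.
Qed.

(** For positive [j] both products share the factors with [i < l < i + j]; the leftover factors
    differ by [x * j%:R]. At [j = 0] the truncated predecessor is harmless, its coefficient being
    0. *)
Lemma arith_prod_diff i j :
  arith_prod i.+1 j - arith_prod i j = x * j%:R * arith_prod i.+1 j.-1.
Proof.
case: j => [|j]; first by rewrite !arith_prod0 subrr mulr0 mul0r.
rewrite [arith_prod i _]arith_prodSl arith_prodSr /= addSn.
by rewrite -!natr1 natrD; ring.
Qed.

(** Chosen rows of a minor need not be adjacent, so the unit-step differences are telescoped between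
    them. *)
Lemma arith_prod_diff_sum a b j : (a <= b)%N ->
  arith_prod b j - arith_prod a j =
  \sum_(a <= t < b) x * j%:R * arith_prod t.+1 j.-1.
Proof.
move=> leab; rewrite -(telescope_sumr (fun t => arith_prod t j)) //.
by apply: eq_bigr => t _; rewrite arith_prod_diff.
Qed.

(** Stands for the polynomials with nonnegative coefficients; only closure under sums and products,
    with 0 and 1, matters. *)
Variable S : semiringClosed A.
Hypotheses (Sz : z \in S) (Sx : x \in S).

Lemma arith_prod_minor_closed m (i j : 'I_m -> nat) :
  {homo i : r s / (r < s)%N} -> {homo j : r s / (r < s)%N} ->
  \det (\matrix_(r < m, s < m) arith_prod (i r) (j s)) \in S.
Proof.
have Sfactor l : z + x * l%:R \in S by rewrite rpredD ?rpredM ?rpred_nat.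
elim: m i j => [|m IHm] i j; first by rewrite det_mx00 rpred1.
(* Inside the induction on the order of the minor, a second one on its first column index. *)
move Dk: (j ord0) => k; elim: k i j Dk => [|k IHk] i j Dk hi hj.
  pose N := i ord_max.
  pose F (r : nat) (s : 'I_m.+1) := arith_prod (i (inord r)) (j s).
  have -> : \matrix_(r, s) arith_prod (i r) (j s) = \matrix_(r, s) F r s.
    by apply/matrixP => r s; rewrite !mxE /F inord_val.
  rewrite (det_col1_row_diff (F := F)) => [|r]; last by rewrite /F Dk arith_prod0.
  (* The telescoping range between rows [r] and [r.+1]. All these ranges lie below the last row
     index [N], so ['I_N] indexes them at once. *)
  pose Q (r : 'I_m) := [pred t : 'I_N | (i (inord r) <= t < i (inord r.+1))%N].
  have ile (r s : nat) : (r <= s <= m)%N -> (i (inord r) <= i (inord s))%N.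
    case/andP; rewrite leq_eqVlt => /predU1P[-> //|ltrs lesm].
    by apply/ltnW/hi; rewrite !inordK // ltnS // (leq_trans (ltnW ltrs)).
  pose G (t : 'I_N) (s : 'I_m) := x * (j (lift ord0 s))%:R *
     arith_prod t.+1 (j (lift ord0 s)).-1.
  have -> : \matrix_(r < m, s < m)
        (F r.+1 (lift ord0 s) - F r (lift ord0 s)) =
      \matrix_(r < m, s < m) \sum_(t | Q r t) G t s.
    apply/matrixP => r s; rewrite !mxE arith_prod_diff_sum ?ile ?leqnSn ?ltn_ord //.
    have leN : (i (inord r.+1) <= N)%N.
      suff -> : N = i (inord m) by rewrite ile ?leqnn ?andbT ?ltn_ord.
      by rewrite /N; congr i; apply: val_inj; rewrite /= inordK.
    rewrite (big_nat_widen _ _ _ _ _ leN) (big_nat_widenl _ 0) // big_mkord.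
    by apply: eq_bigl => t; rewrite /= andbC.
  rewrite (det_sum_rows Q G); apply: rpred_sum => f /familyP fQ.
  rewrite /G; under eq_mx do rewrite -[x * _]mul1r.
  rewrite (det_scale_rows_cols (fun=> 1) (fun s => x * (j (lift ord0 s))%:R)).
  apply: rpredM; first apply: rpredM.
  - by apply: rpred_prod => r _; apply: rpred1.
  - by apply: rpred_prod => s _; rewrite rpredM ?rpred_nat.
  have jpos s : (0 < j (lift ord0 s))%N by rewrite -[X in (X < _)%N]Dk hj.
  apply: (IHm (fun r => (f r).+1) (fun s => (j (lift ord0 s)).-1)).
    (* Distinct rows draw from disjoint consecutive ranges: [f r < i (r+1) <= i s <= f s], so the
       new row indices increase strictly. *)
    move=> r s ltrs; have /andP[_ ltf] := fQ r; have /andP[lef _] := fQ s.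
    rewrite ltnS; apply: leq_trans ltf (leq_trans _ lef).
    by apply: ile; rewrite ltrs ltnW ?ltn_ord.
  by move=> r s ltrs; rewrite -ltnS !prednK // hj.
(* Positive first column index: every column is positive, so each row yields its first factor and
   all column indices drop by one. *)
have jpos s : (0 < j s)%N.
  have [->|ne0] := eqVneq s ord0; first by rewrite Dk.
  by apply: leq_ltn_trans (hj ord0 s _); rewrite // lt0n.
have -> : \matrix_(r, s) arith_prod (i r) (j s) = \matrix_(r, s)
    ((z + x * (i r)%:R) * 1 * arith_prod (i r).+1 (j s).-1).
  by apply/matrixP => r s; rewrite !mxE mulr1 -arith_prodSl prednK.
rewrite (det_scale_rows_cols (fun r => z + x * (i r)%:R) (fun=> 1)
  (fun r s => arith_prod (i r).+1 (j s).-1)).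
apply: rpredM; first apply: rpredM.
- by apply: rpred_prod => r _; apply: Sfactor.
- by apply: rpred_prod => s _; apply: rpred1.
apply: (IHk (fun r => (i r).+1) (fun s => (j s).-1)).
- by rewrite Dk.
- by move=> r s /hi.
- by move=> r s ltrs; rewrite -ltnS !prednK // hj.
Qed.

Lemma arith_prod_hankel_minor_closed m (i j : 'I_m -> nat) :
  {homo i : r s / (r < s)%N} -> {homo j : r s / (r < s)%N} ->
  \det (\matrix_(r < m, s < m) arith_prod 0 (i r + j s)) \in S.
Proof.
move=> hi hj.
have -> : \matrix_(r, s) arith_prod 0 (i r + j s) = \matrix_(r, s)
    (arith_prod 0 (i r) * 1 * arith_prod (i r) (j s)).
  by apply/matrixP => r s; rewrite !mxE mulr1 arith_prodD.
rewrite (det_scale_rows_cols (fun r => arith_prod 0 (i r)) (fun=> 1)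
  (fun r s => arith_prod (i r) (j s))).
apply: rpredM; last exact: arith_prod_minor_closed.
apply: rpredM; apply: rpred_prod => r _; last exact: rpred1.
by apply: rpred_prod => l _; rewrite rpredD ?rpredM ?rpred_nat.
Qed.

End ArithmeticProducts.

Lemma row_gen_at_mu (A : comNzRingType) (a0 a2 b0 b1 b2 mu : A)
    (T : nat -> nat -> A) :
  T 0%N 0%N = 1 ->
  (forall n k : nat, ~~ (k <= n)%N -> T n k = 0) ->
  (forall n k : nat, (1 <= n)%N ->
     T n k = (a0 * n%:R - mu * b1 * k%:R + a2) * T n.-1 k
           + (b0 * n%:R + b1 * k%:R + b2)
             * (if k is k'.+1 then T n.-1 k' else 0)) ->
  forall n, (row_gen T n).[mu] =
    arith_prod (a0 + a2 + (b0 + b1 + b2) * mu) (a0 + b0 * mu) 0 n.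
Proof.
move=> T00 Tout Trec; elim=> [|n IHn].
  by rewrite /row_gen horner_poly big_ord1 T00 mulr1 arith_prod0.
rewrite arith_prodSr -IHn /row_gen !horner_poly mulr_suml.
under eq_bigr do rewrite Trec // mulrDl.
(* The first sum loses its top term since [T n n.+1] is 0, the second its term at 0. After a shift
   of the second, both run over [k <= n], and the multiples of [k] cancel termwise. *)
rewrite big_split /= big_ord_recr /= [T n n.+1]Tout ?ltnn // mulr0 mul0r addr0.
rewrite [X in _ + X]big_ord_recl /= (mulr0 (_ + _)) mul0r add0r -big_split /=.
apply: eq_bigr => k _; rewrite /bump /= add1n exprS.
by rewrite !add0n -!natr1; ring.
Qed.

(* The library makes [mpolyOver n S] a semiring predicate only for a subring
   [S], which [Num.nneg] is not. *)
Definition nneg_mpoly (R : numDomainType) n : {pred {mpoly R[n]}} :=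
  fun p => p \is a mpolyOver n Num.nneg.

Lemma nneg_mpoly_semiring_closed (R : numDomainType) n :
  semiring_closed (@nneg_mpoly R n).
Proof.
split; first exact: mpolyOver_addr_closed.
exact: mpolyOver_mulr_closed.
Qed.

HB.instance Definition _ (R : numDomainType) n :=
  GRing.isSemiringClosed.Build {mpoly R[n]} (@nneg_mpoly R n)
    (@nneg_mpoly_semiring_closed R n).

Theorem theorem1p8 (R : numDomainType) (T : nat -> nat -> {mpoly R[6]}) :
  let a0 : {mpoly R[6]} := 'X_(inord 0) in
  let a2 : {mpoly R[6]} := 'X_(inord 1) in
  let b0 : {mpoly R[6]} := 'X_(inord 2) in
  let b1 : {mpoly R[6]} := 'X_(inord 3) in
  let b2 : {mpoly R[6]} := 'X_(inord 4) in
  let mu : {mpoly R[6]} := 'X_(inord 5) in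
  T 0%N 0%N = 1 ->
  (forall n k : nat, ~~ (k <= n)%N -> T n k = 0) ->
  (forall n k : nat, (1 <= n)%N ->
     T n k = (a0 * n%:R - mu * b1 * k%:R + a2) * T n.-1 k
           + (b0 * n%:R + b1 * k%:R + b2)
             * (if k is k'.+1 then T n.-1 k' else 0)) ->
  x_Stieltjes_moment (fun n : nat => (row_gen T n).[mu]).
Proof.
move=> a0 a2 b0 b1 b2 mu T00 Tout Trec m i j hi hj.
have SX k : 'X_k \in @nneg_mpoly R 6 by apply: mpolyOverX.
rewrite /hankel; under eq_mx do rewrite (row_gen_at_mu T00 Tout Trec).
by apply: (arith_prod_hankel_minor_closed (S := @nneg_mpoly R 6));
  rewrite // !(rpredD, rpredM) ?SX.
Qed.
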